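(* Let $1/2<c\le 1$. There exist a constant $K=K(c)>0$ and $n_0=n_0(c)$ such that for every $n\ge n_0$ the following holds. If $G$ is a balanced bipartite graph on $2n$ vertices (both parts of size $n$) with $\delta(G)\ge cn$, then for every proper edge-colouring $\chi$ of $G$, the graph $G$ contains a perfect matching whose edges receive at least $cn-Kn^{2/3}$ distinct colours under $\chi$.
   Context: A proper edge-colouring assigns colours to edges so that edges sharing a vertex receive different colours. (The paper states the bound as $cn-O(n^{2/3})$, with the implicit constant depending only on $c$.) Equivalently: every subset of an $n\times n$ Latin square with at least $cn$ cells in each row and column contains a permutation with at least $cn-O(n^{2/3})$ distinct symbols. *)

(* Defs.v *)
From mathcomp Require Import all_boot.

Set Implicit Arguments.
Unset Strict Implicit.
Unset Printing Implicit Defensive.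

Record sgraph (V : finType) := SGraph {
  adj : rel V;
  adj_sym : symmetric adj;
  adj_irrefl : irreflexive adj }.

Section Graph.
Variables (V : finType) (G : sgraph V).

(* An edge is the two-element set of its endpoints. *)
Definition edges : {set {set V}} :=
  [set [set p.1; p.2] | p : V * V & adj G p.1 p.2].

Definition degree (v : V) : nat := #|[set u | adj G v u]|.

(* Every degree is at most #|V|, so the default value only matters when V is
   empty. *)
Definition min_degree : nat := \big[minn/#|V|]_(v : V) degree v.

Definition bipartition (A B : {set V}) : Prop :=
  [/\ A :|: B = [set: V], A :&: B = set0
    & forall u v, adj G u v ->
        (u \in A) && (v \in B) || (u \in B) && (v \in A)].

Definition balanced_bipartite (n : nat) : Prop :=
  exists A B : {set V}, [/\ bipartition A B, #|A| = n & #|B| = n].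

(* Colourings are total functions on {set V}; only their values on the edges
   of G are constrained and counted. *)
Definition proper_edge_colouring (C : eqType) (chi : {set V} -> C) : Prop :=
  forall e f : {set V}, e \in edges -> f \in edges ->
    e != f -> e :&: f != set0 -> chi e != chi f.

Definition matching (M : {set {set V}}) : Prop :=
  M \subset edges /\
  forall e f : {set V}, e \in M -> f \in M -> e != f -> e :&: f = set0.

Definition perfect_matching (M : {set {set V}}) : Prop :=
  matching M /\ forall v : V, exists2 e, e \in M & v \in e.

End Graph.

Definition num_colours (V : finType) (C : eqType) (chi : {set V} -> C)
    (M : {set {set V}}) : nat :=
  size (undup [seq chi e | e <- enum M]).

(* Main.v *)
(** With d = delta(G) > n/2, a matching of size m < n extends to one of size
    m + 1 at the cost of at most one colour: unmatched a and b have together at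
    least 2d > n > m neighbours, so if no edge can be added outright then some
    matching edge xy has ay and xb in G, and xy is replaced by these two.

    Let y be about n^(1/3). It then suffices to find a matching of size
    n - 2y^2 with d - 2y^2 colours, i.e. one split as F + R with R rainbow and
    |R| = d - 2y^2. Suppose R is smaller and cannot be enlarged at the expense
    of F. Call a colour of R releasable if a bounded number of switches, adding
    edges at unmatched vertices, turns R into an equally large rainbow matching
    avoiding it. Take a new unmatched vertex a. At most |R| minus the number of
    releasable colours of its edges have a non-releasable colour of R. Along
    every other edge ab a further switch is possible, unless b was already
    touched by the switches releasing the colour of ab; averaging over the 2y^2
    unmatched vertices, some a has at most y^2 such exceptional edges. As R
    cannot be enlarged, the switches all end in R and release distinct
    colours, so the number of releasable colours grows by y^2 each time. After
    y rounds it is y^3 > n, a contradiction. *)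
Require Import Defs.
From mathcomp Require Import all_boot all_order all_algebra.
From mathcomp Require Import boolp reals exp.
From mathcomp Require Import zify ring lra.

Set Implicit Arguments.
Unset Strict Implicit.
Unset Printing Implicit Defensive.
Import Order.TTheory GRing.Theory Num.Theory.

(** * Matchings in a bipartite edge set, and their extension at a small cost in colours *)

Section ColouredMatchings.
Variables (S T C : finType) (E : {set S * T}) (col : S * T -> C).

Definition is_matching (M : {set S * T}) :=
  [/\ M \subset E, {in M &, injective fst} & {in M &, injective snd}].

Lemma is_matchingS (M N : {set S * T}) :
  N \subset M -> is_matching M -> is_matching N.
Proof.
move=> /subsetP NM [ME M1 M2]; split.
- by apply/subsetP => e /NM; apply: (subsetP ME).
- by move=> e f /NM eM /NM fM; apply: M1.
- by move=> e f /NM eM /NM fM; apply: M2.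
Qed.

Lemma is_matchingU1 (M : {set S * T}) (e : S * T) :
  is_matching M -> e \in E -> e.1 \notin [set f.1 | f in M] ->
  e.2 \notin [set f.2 | f in M] -> is_matching (e |: M).
Proof.
move=> [ME M1 M2] eE e1 e2; split.
- by rewrite subUset sub1set eE.
- move=> f g /setU1P[->|fM] /setU1P[->|gM] // fg; last exact: M1.
  + by rewrite fg imset_f in e1.
  + by rewrite -fg imset_f in e1.
- move=> f g /setU1P[->|fM] /setU1P[->|gM] // fg; last exact: M2.
  + by rewrite fg imset_f in e2.
  + by rewrite -fg imset_f in e2.
Qed.

Lemma notin_imsetD1 (D : finType) (f : S * T -> D) (M : {set S * T}) (e : S * T) :
  {in M &, injective f} -> e \in M -> f e \notin [set f g | g in M :\ e].
Proof.
move=> fI eM; apply/imsetP => -[g /setD1P[ge gM] fe].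
by rewrite (fI _ _ eM gM fe) eqxx in ge.
Qed.

Lemma notin_imsetS (D : finType) (f : S * T -> D) (M N : {set S * T}) x :
  N \subset M -> x \notin [set f g | g in M] -> x \notin [set f g | g in N].
Proof. by move=> NM; apply: contra; apply/subsetP/imsetS. Qed.

Lemma exists_notin_imset (D : finType) (f : S * T -> D) (M : {set S * T}) :
  #|M| < #|D| -> exists x, x \notin [set f g | g in M].
Proof.
move=> lt; have: 0 < #|~: [set f g | g in M]|.
  by rewrite cardsCs setCK subn_gt0 (leq_ltn_trans (leq_imset_card _ _)).
by case/card_gt0P => x; rewrite inE => ?; exists x.
Qed.

Variables (n delta : nat).
Hypotheses (cardS : #|S| = n) (cardT : #|T| = n).
Hypothesis degS : forall a, delta <= #|[set b | (a, b) \in E]|.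
Hypothesis degT : forall b, delta <= #|[set a | (a, b) \in E]|.

Lemma matching_extend (M : {set S * T}) :
  n < delta.*2 -> is_matching M -> #|M| < n ->
  exists M', [/\ is_matching M', #|M'| = #|M|.+1
    & #|[set col e | e in M]| <= #|[set col e | e in M']|.+1].
Proof.
move=> nd mM ltM; have [ME M1 M2] := mM.
have ext e : e \in E -> e.1 \notin [set f.1 | f in M] ->
    e.2 \notin [set f.2 | f in M] ->
    exists M', [/\ is_matching M', #|M'| = #|M|.+1
    & #|[set col e | e in M]| <= #|[set col e | e in M']|.+1].
  move=> eE e1 e2; exists (e |: M); split; first exact: is_matchingU1.
    by rewrite cardsU1 (contra _ e1) //; apply: imset_f.
  by rewrite leqW // subset_leq_card // imsetS // subsetUr.
have [a aM] : exists a, a \notin [set f.1 | f in M].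
  by apply: exists_notin_imset; rewrite cardS.
have [b bM] : exists b, b \notin [set f.2 | f in M].
  by apply: exists_notin_imset; rewrite cardT.
have [/existsP[y /andP[ay yM]]|/existsPn noy] :=
  boolP [exists y, ((a, y) \in E) && (y \notin [set f.2 | f in M])].
  exact: (ext (a, y)).
have [/existsP[x /andP[xb xM]]|/existsPn nox] :=
  boolP [exists x, ((x, b) \in E) && (x \notin [set f.1 | f in M])].
  exact: (ext (x, b)).
pose P := [set e in M | (a, e.2) \in E].
pose Q := [set e in M | (e.1, b) \in E].
have dP : delta <= #|P|.
  apply: leq_trans (degS a) (leq_trans (subset_leq_card _) (leq_imset_card snd P)).
  apply/subsetP => y; rewrite inE => ay.
  have := noy y; rewrite ay negbK => /imsetP[e eM ye].
  by apply/imsetP; exists e; rewrite // inE eM -ye.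
have dQ : delta <= #|Q|.
  apply: leq_trans (degT b) (leq_trans (subset_leq_card _) (leq_imset_card fst Q)).
  apply/subsetP => x; rewrite inE => xb.
  have := nox x; rewrite xb negbK => /imsetP[e eM xe].
  by apply/imsetP; exists e; rewrite // inE eM -xe.
have PQ : #|P :|: Q| <= #|M|.
  by apply/subset_leq_card/subsetP => e; rewrite !inE => /orP[] /andP[].
have : 0 < #|P :&: Q| by have := cardsUI P Q; lia.
case/card_gt0P => e; rewrite !inE => /andP[/andP[eM ae] /andP[_ eb]].
have sub := subsetDl M [set e].
have m1 : is_matching ((a, e.2) |: M :\ e).
  apply: is_matchingU1 => //=; first exact: is_matchingS mM.
    exact: notin_imsetS aM.
  exact: notin_imsetD1.
have ane : a != e.1 by apply: contraNneq aM => ->; apply: imset_f.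
have bne : b != e.2 by apply: contraNneq bM => ->; apply: imset_f.
exists ((e.1, b) |: ((a, e.2) |: M :\ e)); split.
- apply: is_matchingU1 => //=; rewrite imsetU1 !inE negb_or.
    by rewrite eq_sym ane notin_imsetD1.
  by rewrite bne (notin_imsetS sub).
- have h1 : (a, e.2) \notin M :\ e.
    by apply: contra (notin_imsetS sub aM) => /(imset_f fst).
  have h2 : (e.1, b) \notin (a, e.2) |: M :\ e.
    rewrite in_setU1 negb_or xpair_eqE eq_sym (negPf ane) /=.
    by apply: contra (notin_imsetS sub bM) => /(imset_f snd).
  by rewrite cardsU1 h2 cardsU1 h1 (cardsD1 e M) eM.
(* Only [e] leaves the matching, so [col e] is the only colour that can be lost. *)
- have sM : [set col f | f in M] \subset
      col e |: [set col f | f in (e.1, b) |: ((a, e.2) |: M :\ e)].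
    rewrite -imsetU1; apply: imsetS; apply/subsetP => f fM.
    by rewrite !inE fM andbT; case: eqP; rewrite ?orbT.
  apply: leq_trans (subset_leq_card sM) _.
  by rewrite cardsU1; case: (_ \in _); rewrite ?add0n ?add1n.
Qed.

Lemma matching_extendn (M : {set S * T}) (m : nat) :
  n < delta.*2 -> is_matching M -> #|M| + m <= n ->
  exists M', [/\ is_matching M', #|M'| = #|M| + m
    & #|[set col e | e in M]| <= #|[set col e | e in M']| + m].
Proof.
move=> nd mM; elim: m => [|m IH] leM.
  by exists M; rewrite !addn0.
have [|M1 [mM1 cM1 kM1]] := IH; first by lia.
have [|M2 [mM2 cM2 kM2]] := matching_extend nd mM1; first by lia.
by exists M2; split => //; lia.
Qed.

(** * Matchings with a distinguished rainbow part *)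

Hypothesis properS : forall a b b', (a, b) \in E -> (a, b') \in E ->
  col (a, b) = col (a, b') -> b = b'.
Hypothesis properT : forall a a' b, (a, b) \in E -> (a', b) \in E ->
  col (a, b) = col (a', b) -> a = a'.

(** [R] carries the colours that are counted; [F] is a reserve of edges of arbitrary colours,
    possibly shared with [R], that may be sacrificed. *)
Definition rainbow_split (F R : {set S * T}) :=
  [/\ is_matching (F :|: R), [disjoint F & R] & {in R &, injective col}].

Lemma rainbow_splitU1 (F R : {set S * T}) (e : S * T) :
  rainbow_split F R -> e \in E -> e.1 \notin [set f.1 | f in F :|: R] ->
  e.2 \notin [set f.2 | f in F :|: R] -> col e \notin [set col f | f in R] ->
  rainbow_split F (e |: R).
Proof.
move=> [mFR dFR iR] eE e1 e2 ce; split.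
- by rewrite setUCA; apply: is_matchingU1.
- rewrite disjoints_subset setCU subsetI -!disjoints_subset dFR andbT disjoint_sym disjoints1.
  by apply: contra e1 => eF; rewrite imset_f // inE eF.
- move=> f g /setU1P[->|fM] /setU1P[->|gM] // fg; last exact: iR.
  + by rewrite fg imset_f in ce.
  + by rewrite -fg imset_f in ce.
Qed.

Lemma rainbow_splitS (F R F' R' : {set S * T}) :
  F' \subset F -> R' \subset R -> rainbow_split F R -> rainbow_split F' R'.
Proof.
move=> FF RR [mFR dFR iR]; split.
- exact: is_matchingS (setUSS FF RR) mFR.
- exact: disjointWl FF (disjointWr RR dFR).
- by move=> f g /(subsetP RR) ? /(subsetP RR) ?; apply: iR.
Qed.

(** Only [F] can cover an endpoint of [e], and it does so by at most one edge, which is dropped to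
    make room. *)
Lemma rainbow_split_grow (F R : {set S * T}) (e : S * T) :
  rainbow_split F R -> 0 < #|F| -> e \in E ->
  e.1 \notin [set f.1 | f in F :|: R] -> e.2 \notin [set f.2 | f in R] ->
  col e \notin [set col f | f in R] ->
  exists F', rainbow_split F' (e |: R) /\ #|F'|.+1 = #|F|.
Proof.
move=> sFR F0 eE e1 e2 ce; have [mFR _ _] := sFR.
(* If no edge of [F] ends at [e.2], an arbitrary one is dropped, so that the total size is the same
   in both cases. *)
have [f fF ef] : exists2 f, f \in F & e.2 \notin [set g.2 | g in F :\ f].
  have [/imsetP[f fF ->]|e2F] := boolP (e.2 \in [set g.2 | g in F]).
    exists f => //; apply: notin_imsetD1 => //.
    by have [] := is_matchingS (subsetUl F R) mFR.
  have /card_gt0P[f fF] := F0; exists f => //.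
  exact: notin_imsetS (subsetDl _ _) e2F.
exists (F :\ f); split; last by rewrite (cardsD1 f F) fF.
apply: rainbow_splitU1 => //.
- exact: rainbow_splitS (subsetDl _ _) (subxx _) sFR.
- exact: notin_imsetS (setSU _ (subsetDl _ _)) e1.
- by rewrite imsetU inE negb_or ef.
Qed.

(** The basic switch: [e] takes over the [T]-endpoint of [f], and the colour of [f] becomes free. *)
Lemma rainbow_split_swap (F R : {set S * T}) (e f : S * T) :
  rainbow_split F R -> f \in R -> e \in E -> e.2 = f.2 ->
  e.1 \notin [set g.1 | g in F :|: R] -> col e \notin [set col g | g in R] ->
  [/\ rainbow_split F (e |: R :\ f), #|e |: R :\ f| = #|R|
    & col f \notin [set col g | g in e |: R :\ f]].
Proof.
move=> sFR fR eE ef e1 ce; have [[ME M1 M2] dFR iR] := sFR.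
have fFR : f \in F :|: R by rewrite inE fR orbT.
have sub := subsetDl R [set f].
have fF : f \notin F by rewrite (disjointFl dFR fR).
have eD : F :|: R :\ f = (F :|: R) :\ f.
  by rewrite setDUl; congr (_ :|: _); apply/esym/setDidPl; rewrite disjoint_sym disjoints1.
split.
- apply: rainbow_splitU1 => //.
  + exact: rainbow_splitS sFR.
  + exact: notin_imsetS (setUS _ sub) e1.
  + by rewrite ef eD notin_imsetD1.
  + exact: notin_imsetS ce.
- rewrite cardsU1 (cardsD1 f R) fR; case: (boolP (e \in _)) => //= eR.
  by move: e1; rewrite imset_f // inE (subsetP sub _ eR) orbT.
- rewrite imsetU1 inE negb_or notin_imsetD1 // andbT inE.
  by apply: contraNneq ce => <-; apply: imset_f.
Qed.

(** * Switching: enlarging the rainbow part at the expense of [F] *)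

Section Switching.

Variables (F R : {set S * T}) (y : nat).
Hypotheses (sFR : rainbow_split F R) (F0 : 0 < #|F|).
Hypothesis few_colours : #|R| + 2 * y ^ 2 <= delta.
Hypothesis many_unmatched : #|F| + #|R| + 2 * y ^ 2 <= n.
Hypothesis y_large : n < y ^ 3.

Let U := ~: [set e.1 | e in F :|: R].

(* [X] contains every [T]-vertex at which [R'] differs from [R]; the unmatched
   vertices used by the switches lie in [Z]. *)
Definition shifted (Z : {set S}) (i : nat) (q : C)
    (R' : {set S * T}) (X : {set T}) :=
  [/\ rainbow_split F R' /\ #|R'| = #|R|, q \notin [set col e | e in R'],
      forall e, e \in R' -> e.1 \in U -> e.1 \in Z, #|X| <= i
    & forall e, e.2 \notin X -> (e \in R') = (e \in R)].

(** One [Z] serves all colours of [Q], so a vertex of [U] outside [Z] is still unmatched after any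
    of these switches. *)
Definition releasable (i : nat) (Z : {set S}) (Q : {set C}) :=
  [/\ Z \subset U, #|Z| = i, Q \subset [set col e | e in R], i * y ^ 2 <= #|Q|
    & forall q, q \in Q -> exists R' X, shifted Z i q R' X].

Definition growable := exists F' R', [/\ rainbow_split F' R',
  #|F'| + #|R'| = #|F| + #|R| & #|R'| = #|R|.+1].

Lemma card_unmatched : 2 * y ^ 2 <= #|U|.
Proof.
rewrite /U cardsCs setCK cardS.
suff : #|[set e.1 | e in F :|: R]| <= #|F| + #|R| by lia.
exact: leq_trans (leq_imset_card _ _) (leq_card_setU _ _).
Qed.

(** The colour of [(a, b)] is absent from [R']. If [R'] misses [b], adding [(a, b)] would enlarge
    the rainbow part; otherwise the edge of [R'] at [b] is already in [R], because [b] is not in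
    [X], and switching it for [(a, b)] releases its colour. *)
Lemma shifted_step (Z : {set S}) (i : nat) (R' : {set S * T}) (X : {set T}) a b :
  ~ growable -> shifted Z i (col (a, b)) R' X -> a \in U :\: Z ->
  (a, b) \in E -> b \notin X ->
  exists e, [/\ e \in R, e.2 = b
    & exists R1 X1, shifted (a |: Z) i.+1 (col e) R1 X1].
Proof.
move=> ngrow [[sR' cR'] qR' ZR' Xi agree] /setDP[aU aZ] abE bX.
have aFR : (a, b).1 \notin [set e.1 | e in F :|: R'].
  apply/imsetP => -[e /setUP[eF|eR]] /= ae.
    by move: aU; rewrite inE ae imset_f // inE eF.
  by move: aZ; rewrite ae ZR' -?ae.
have [/imsetP[e eR' be]|bR'] := boolP (b \in [set e.2 | e in R']).
  have eR : e \in R by rewrite -agree // -be.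
  have [s1 c1 q1] := rainbow_split_swap sR' eR' abE be aFR qR'.
  exists e; split=> //; exists ((a, b) |: R' :\ e), (b |: X); split=> //.
  - by rewrite c1.
  - move=> g; rewrite !in_setU1 in_setD1.
    by move=> /orP[/eqP-> _|/andP[_ gR'] gU]; rewrite ?eqxx // ZR' ?orbT.
  - by rewrite cardsU1 bX.
  - move=> g; rewrite in_setU1 negb_or => /andP[gb gX].
    rewrite in_setU1 in_setD1 agree //.
    have -> : (g == (a, b)) = false.
      by apply: contraNF gb => /eqP->.
    have -> // : g != e by apply: contraNneq gb => ->; rewrite be.
have [F' [sF' cF']] := rainbow_split_grow sR' F0 abE aFR bR' qR'.
case: ngrow; exists F', ((a, b) |: R').
have c1 : #|(a, b) |: R'| = #|R|.+1.
  by rewrite cardsU1 cR' (contra _ bR') // => /(imset_f snd).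
by split=> //; rewrite c1; lia.
Qed.

(* A pair (q, b) with b in [X q] blocks at most one a, as the colouring is proper
   at b; hence the average over [W]. *)
Lemma few_blocked (W : {set S}) (Q : {set C}) (X : C -> {set T}) (i m : nat) :
  (forall q, q \in Q -> #|X q| <= i) -> #|Q| * i < m.+1 * #|W| ->
  exists2 a, a \in W & #|[set b | [&& (a, b) \in E, col (a, b) \in Q
    & b \in X (col (a, b))]]| <= m.
Proof.
move=> Xi lt; pose B a := [set b | [&& (a, b) \in E, col (a, b) \in Q
    & b \in X (col (a, b))]].
have [/exists_inP[a aW]|/exists_inPn noa] :=
  boolP [exists a in W, #|B a| <= m]; first by exists a.
suff: m.+1 * #|W| <= #|Q| * i by rewrite leqNgt lt.
apply: (@leq_trans (\sum_(a in W) #|B a|)).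
  rewrite mulnC -sum_nat_const; apply: leq_sum => a /noa.
  by rewrite -ltnNge.
apply: (@leq_trans (\sum_(q in Q) #|X q|)); last first.
  by rewrite -sum_nat_const; apply: leq_sum.
have sumE (D D' : finType) (A : {set D}) (f : D -> {set D'}) :
    \sum_(a in A) #|f a| = #|[set p | (p.1 \in A) && (p.2 \in f p.1)]|.
  transitivity (\sum_(a in A) \sum_(b in f a) 1).
    by apply: eq_bigr => a _; rewrite sum1_card.
  by rewrite pair_big_dep sum1dep_card.
rewrite !sumE.
rewrite -(@card_in_imset _ _ (fun e : S * T => (col e, e.2))).
  apply/subset_leq_card/subsetP => _ /imsetP[[a b] + ->].
  by rewrite !inE /= => /andP[_ /and3P[_ -> ->]].
move=> [a b] [a' b']; rewrite !inE /= => /andP[_ /and3P[abE _ _]].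
move=> /andP[_ /and3P[abE' _ _]] [cc bb]; subst b'.
by rewrite (properT abE abE' cc).
Qed.

Lemma releasable_step (i : nat) (Z : {set S}) (Q : {set C}) :
  ~ growable -> i < y -> releasable i Z Q ->
  exists Z' Q', releasable i.+1 Z' Q'.
Proof.
move=> ngrow iy [ZU cZ QR cQ QP]; have [[ME M1 M2] dFR iR] := sFR.
have /fin_all_exists[f fP] : forall q, exists f : {set S * T} * {set T},
    q \in Q -> shifted Z i q f.1 f.2.
  move=> q; have [/QP[R' [X RX]]|_] := boolP (q \in Q); last by exists (set0, set0).
  by exists (R', X).
(* Of at least [2 * y ^ 2] unmatched vertices, only [i < y <= y ^ 2] have been used. *)
have cW : y ^ 2 <= #|U :\: Z|.
  have := cardsID Z U; rewrite (setIidPr ZU) cZ.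
  by have := card_unmatched; nia.
have colR : #|[set col e | e in R]| = #|R| by rewrite card_in_imset.
have cQR : #|Q| <= #|R| by rewrite -colR subset_leq_card.
(* There are at most [y ^ 4] blocking pairs, as [#|Q| <= n < y ^ 3] and [i < y], to be shared among
   at least [y ^ 2] vertices. *)
have [||a aW] := @few_blocked (U :\: Z) Q (fun q => (f q).2) i (y ^ 2).
- by move=> q /fP[].
- have : #|R| <= n by lia.
  nia.
set B := [set b | _] => cB.
(* The neighbours of [a] are covered by [G], where a switch is possible, the blocked set [B], and
   [H], whose colours in [R] are not known to be releasable. *)
pose G := [set b | [&& (a, b) \in E,
  (col (a, b) \in Q) || (col (a, b) \notin [set col e | e in R]) & b \notin B]].
pose H := [set b | (a, b) \in E & col (a, b) \in [set col e | e in R] :\: Q].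
have cH : #|H| + #|Q| <= #|R|.
  rewrite -[#|R|]colR -(cardsID Q [set col e | e in R]) (setIidPr QR) addnC leq_add2l.
  rewrite -(@card_in_imset _ _ (fun b => col (a, b)) H).
    by apply/subset_leq_card/subsetP => _ /imsetP[b + ->]; rewrite inE => /andP[].
  by move=> b b'; rewrite !inE => /andP[? _] /andP[? _]; apply: properS.
(* Of the surplus [2 * y ^ 2] of [delta] over [#|R|], the set [B] uses up at most [y ^ 2]. *)
have cG : #|Q| + y ^ 2 <= #|G|.
  have : #|[set b | (a, b) \in E]| <= #|G| + (#|B| + #|H|).
    apply: leq_trans (leq_trans (leq_card_setU _ _) (leq_add (leqnn _) (leq_card_setU _ _))).
    apply/subset_leq_card/subsetP => b; rewrite !inE => ->/=.
    by case: (col (a, b) \in Q); case: (_ \in imset _ _); case: (b \in (f _).2).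
  have := degS a; lia.
have GP b : b \in G -> exists e, [/\ e \in R, e.2 = b
    & exists R1 X1, shifted (a |: Z) i.+1 (col e) R1 X1].
  rewrite inE => /and3P[abE /orP[qQ|qR] bB].
    apply: (shifted_step ngrow (fP _ qQ)) => //.
    by move: bB; rewrite inE abE qQ.
  (* A colour outside [R] needs no release: [R] itself, with nothing touched, serves as the shifted
     matching. *)
  apply: (@shifted_step Z i R set0) => //; last by rewrite inE.
  split=> //; last by rewrite cards0.
  by move=> e eR; rewrite inE imset_f // inE eR orbT.
(* The new set of colours need not contain [Q]; it is large because distinct vertices of [G] lie on
   distinct edges of the rainbow [R]. *)
exists (a |: Z), [set col e | e in [set e in R | e.2 \in G]]; split.
- by rewrite subUset sub1set ZU andbT; case/setDP: aW.
- by rewrite cardsU1 cZ; case/setDP: aW => _ ->.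
- by apply: imsetS; apply/subsetP => e; rewrite inE => /andP[].
- rewrite card_in_imset; last first.
    by move=> e g; rewrite !inE => /andP[? _] /andP[? _]; apply: iR.
  apply: leq_trans (leq_imset_card snd _); apply: (@leq_trans #|G|); first by lia.
  apply/subset_leq_card/subsetP => b bG; have [e [eR eb _]] := GP _ bG.
  by apply/imsetP; exists e; rewrite // inE eR eb.
- move=> _ /imsetP[e + ->]; rewrite inE => /andP[eR /GP[g [gR ge RX]]].
  by rewrite -(M2 g e) // inE ?gR ?eR orbT.
Qed.

Lemma rainbow_split_growable : growable.
Proof.
apply: contrapT => ngrow.
have rel i : i <= y -> exists Z Q, releasable i Z Q.
  elim: i => [_|i IH iy]; last first.
    by have [Z [Q]] := IH (ltnW iy); apply: releasable_step.
  exists set0, set0; split; rewrite ?sub0set ?cards0 //.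
  by move=> q; rewrite inE.
have [Z [Q [_ _ QR cQ _]]] := rel y (leqnn y).
have QleR := leq_trans (subset_leq_card QR) (leq_imset_card _ _).
have : #|R| < y ^ 3 by lia.
by rewrite expnS ltnNge (leq_trans cQ QleR).
Qed.

End Switching.

(** * Assembling a perfect matching with many colours *)

Lemma exists_rainbow_split (y r : nat) :
  n < delta.*2 -> delta <= n -> n < y ^ 3 -> r + 2 * y ^ 2 <= delta ->
  exists F R, [/\ rainbow_split F R, #|F| + #|R| + 2 * y ^ 2 = n & #|R| = r].
Proof.
move=> nd dn ny; elim: r => [|r IH] rd.
  have m0 : is_matching set0 by split; rewrite ?sub0set // => e f; rewrite inE.
  have [|F [mF cF _]] := @matching_extendn set0 (n - 2 * y ^ 2) nd m0.
    by rewrite cards0; lia.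
  exists F, set0; rewrite cF !cards0; split; try lia.
  split; first by rewrite setU0.
    by rewrite disjoints_subset setC0 subsetT.
  by move=> e f; rewrite inE.
have [|F [R [sFR cFR cR]]] := IH; first by lia.
(* [F] is nonempty because [r < delta - 2 * y ^ 2 <= n - 2 * y ^ 2]. *)
have [||||F' [R' [sF cF cR']]] := @rainbow_split_growable F R y sFR; try lia.
by exists F', R'; split=> //; lia.
Qed.

(** The loss [4 * y ^ 2] is twice [2 * y ^ 2]: once for the size of the rainbow part, once for
    matching the remaining vertices. *)
Lemma exists_colourful_matching (y : nat) :
  n < delta.*2 -> delta <= n -> n < y ^ 3 ->
  exists M, [/\ is_matching M, #|M| = n
    & delta <= #|[set col e | e in M]| + 4 * y ^ 2].
Proof.
(* For small [delta] the colour bound is void and any perfect matching will do. *)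
move=> nd dn ny; have [le|lt] := leqP delta (4 * y ^ 2).
  have m0 : is_matching set0 by split; rewrite ?sub0set // => e f; rewrite inE.
  have [|M [mM cM _]] := @matching_extendn set0 n nd m0; first by rewrite cards0.
  by exists M; rewrite cM cards0; split=> //; lia.
have [|F [R [sFR cFR cR]]] := @exists_rainbow_split y (delta - 2 * y ^ 2) nd dn ny.
  by lia.
have [mFR dFR iR] := sFR.
have cU : #|F :|: R| = #|F| + #|R| by move: dFR; rewrite -leq_card_setU => /eqP.
have [|M [mM cM kM]] := @matching_extendn (F :|: R) (2 * y ^ 2) nd mFR.
  by rewrite cU; lia.
exists M; split=> //; first by lia.
have : #|R| <= #|[set col e | e in F :|: R]|.
  by rewrite -(card_in_imset iR) subset_leq_card // imsetS // subsetUr.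
by lia.
Qed.

End ColouredMatchings.

(** * From bipartite edge sets to graphs *)

Lemma card_imset_num_colours (V D : finType) (C : eqType)
    (chi : {set V} -> C) (h : C -> D) (M : {set {set V}}) :
  #|[set h (chi e) | e in M]| <= num_colours chi M.
Proof.
rewrite /num_colours -(size_map h).
apply: leq_trans (card_size _); apply/subset_leq_card/subsetP => _ /imsetP[e eM ->].
by rewrite map_f // mem_undup map_f // mem_enum.
Qed.

Lemma min_degree_le (V : finType) (G : sgraph V) (v : V) :
  min_degree G <= degree G v.
Proof. by rewrite /min_degree -minEnat -leEnat bigmin_le. Qed.

(** The two sides become finite types [S] and [T], and edges become ordered pairs; [edge] translates
    the matching back. *)
Lemma exists_colourful_perfect_matching (V : finType) (G : sgraph V) (n y : nat)
    (C : eqType) (chi : {set V} -> C) :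
  balanced_bipartite G n -> proper_edge_colouring G chi ->
  0 < n -> n < (min_degree G).*2 -> n < y ^ 3 ->
  exists M, perfect_matching G M /\ min_degree G <= num_colours chi M + 4 * y ^ 2.
Proof.
move=> [A [B [[AB1 AB0 ABadj] cA cB]]] prop n0 nd ny.
have AB x : x \in A -> x \in B -> False.
  by move=> xA xB; have := in_set0 x; rewrite -AB0 inE xA xB.
have adjAB u v : u \in A -> adj G u v -> v \in B.
  by move=> uA /ABadj/orP[/andP[]//|/andP[/(AB _ uA)]].
have adjBA u v : v \in B -> adj G u v -> u \in A.
  by move=> vB /ABadj/orP[/andP[]//|/andP[_ /AB/(_ vB)]].
pose S := {x | x \in A}; pose T := {x | x \in B}.
have cS : #|{: S}| = n by rewrite card_sig cA.
have cT : #|{: T}| = n by rewrite card_sig cB.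
have ST (a : S) (b : T) : val a = val b -> False.
  by move=> ab; apply: (AB (val a)); [exact: valP|rewrite ab; exact: valP].
pose edge (p : S * T) := [set val p.1; val p.2].
pose E := [set p : S * T | adj G (val p.1) (val p.2)].
have edgeE p : p \in E -> edge p \in edges G.
  by rewrite inE => pE; apply/imsetP; exists (val p.1, val p.2); rewrite ?inE.
have in_edge1 (p : S * T) (a : S) : val a \in edge p -> a = p.1.
  by rewrite !inE => /orP[/eqP/val_inj|/eqP/ST].
have in_edge2 (p : S * T) (b : T) : val b \in edge p -> b = p.2.
  by rewrite !inE => /orP[/eqP/esym/ST|/eqP/val_inj].
have edge_inj : injective edge.
  move=> p q pq; rewrite [p]surjective_pairing [q]surjective_pairing.
  by congr pair; [apply: in_edge1|apply: in_edge2]; rewrite -pq !inE eqxx ?orbT.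
(* Encodes colours in a finite type without merging colours of edges. *)
pose h (x : C) := [set f | chi f == x].
pose col p := h (chi (edge p)).
have col_chi p q : col p = col q -> chi (edge p) = chi (edge q).
  by move/setP/(_ (edge p)); rewrite !inE eqxx => /esym/eqP.
have proper p q x : p \in E -> q \in E -> x \in edge p -> x \in edge q ->
    col p = col q -> p = q.
  move=> pE qE xp xq /col_chi cpq; apply: contrapT => /eqP pq.
  have := prop _ _ (edgeE _ pE) (edgeE _ qE); rewrite cpq eqxx => H.
  suff: false by []; apply: H; first by rewrite (inj_eq edge_inj).
  by apply/set0Pn; exists x; rewrite inE xp.
have degS (a : S) : min_degree G <= #|[set b | (a, b) \in E]|.
  apply: leq_trans (min_degree_le G (val a)) _.
  apply: leq_trans (subset_leq_card _) (leq_imset_card val _).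
  apply/subsetP => u; rewrite inE => au; have uB := adjAB _ _ (valP a) au.
  by apply/imsetP; exists (exist _ u uB); rewrite ?inE.
have degT (b : T) : min_degree G <= #|[set a | (a, b) \in E]|.
  apply: leq_trans (min_degree_le G (val b)) _.
  apply: leq_trans (subset_leq_card _) (leq_imset_card val _).
  apply/subsetP => u; rewrite inE adj_sym => ub; have uA := adjBA _ _ (valP b) ub.
  by apply/imsetP; exists (exist _ u uA); rewrite ?inE.
have dn : min_degree G <= n.
  have /card_gt0P[a _] : 0 < #|{: S}| by rewrite cS.
  by apply: leq_trans (degS a) _; rewrite -cT max_card.
have [||M [[ME M1 M2] cM kM]] :=
  exists_colourful_matching cS cT degS degT (col := col) _ _ nd dn ny.
- move=> a b b' p q cpq; suff [] : (a, b) = (a, b') by [].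
  by apply: (proper _ _ (val a)) => //; rewrite !inE eqxx.
- move=> a a' b p q cpq; suff [] : (a, b) = (a', b) by [].
  by apply: (proper _ _ (val b)) => //; rewrite !inE eqxx orbT.
exists (edge @: M); split; last first.
  apply: leq_trans kM _; rewrite leq_add2r.
  apply: leq_trans (card_imset_num_colours chi h (edge @: M)).
  by rewrite -imset_comp.
split; first split.
- by apply/subsetP => _ /imsetP[p pM ->]; apply/edgeE/(subsetP ME).
- move=> _ _ /imsetP[p pM ->] /imsetP[q qM ->] pq.
  apply/eqP; apply: contraNT pq => /set0Pn[x]; rewrite inE => /andP[xp xq].
  suff -> : p = q by [].
  move: xp; rewrite !inE => /orP[]/eqP xp; rewrite xp in xq.
    by apply: M1 => //; apply: in_edge1.
  by apply: M2 => //; apply: in_edge2.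
- move=> v; have : v \in A :|: B by rewrite AB1.
  case/setUP => [vA|vB].
    (* A matching of [n] edges has [n] distinct first endpoints, hence covers the whole side;
       likewise for the other side. *)
    have /setP/(_ (exist _ v vA)) : fst @: M = setT.
      by apply/eqP; rewrite eqEcard subsetT cardsT cS card_in_imset // cM /=.
    rewrite [RHS]inE => /imsetP[p pM vp]; exists (edge p); first exact: imset_f.
    by rewrite !inE -vp eqxx.
  have /setP/(_ (exist _ v vB)) : snd @: M = setT.
    by apply/eqP; rewrite eqEcard subsetT cardsT cT card_in_imset // cM /=.
  rewrite [RHS]inE => /imsetP[p pM vp]; exists (edge p); first exact: imset_f.
  by rewrite !inE -vp eqxx orbT.
Qed.

(** * Real estimates and the choice of constants *)

Local Open Scope ring_scope.

(** With [x] the cube root of [n], take [y] to be the integer part of [x] plus one: then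
    [x < y <= x + 1 <= 2 * x], as [x >= 1]. *)
Lemma exists_cube_root_bound (R : realType) (n : nat) : (0 < n)%N ->
  exists y : nat, (n < y ^ 3)%N /\ (4 * y ^ 2)%:R <= 16 * n%:R `^ (2 / 3) :> R.
Proof.
move=> n0; set x : R := n%:R `^ (1 / 3).
have x1 : 1 <= x.
  have n1 : 1 <= n%:R :> R by rewrite ler1n.
  have <- : 1 `^ (1 / 3) = 1 :> R by rewrite powR1.
  by rewrite ge0_ler_powR ?nnegrE ?ler0n //; lra.
have xX k : n%:R `^ (k%:R / 3) = x ^+ k.
  by rewrite -powR_mulrn ?powR_ge0 // -powRrM; congr (_ `^ _); field.
have x3 : n%:R = x ^+ 3 by rewrite -xX divff ?powRr1 // pnatr_eq0.
have /andP[yx xy] := truncn_itv (le_trans ler01 x1).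
exists (Num.trunc x).+1; split.
  by rewrite -(ltr_nat R) natrX x3 ltrXn2r // (le_trans ler01).
rewrite xX natrM natrX; set z := Num.trunc x in yx xy *.
rewrite -[z.+1]addn1 natrD; nra.
Qed.

Theorem theorem1p6 (R : realType) (c : R) (hc : 1 / 2 < c <= 1) :
  exists (K : R) (n0 : nat), 0 < K /\
    forall n : nat, (n0 <= n)%N ->
    forall (V : finType) (G : sgraph V),
      balanced_bipartite G n ->
      c * n%:R <= (min_degree G)%:R ->
    forall (C : eqType) (chi : {set V} -> C),
      proper_edge_colouring G chi ->
    exists M : {set {set V}},
      perfect_matching G M /\
      c * n%:R - K * n%:R `^ (2 / 3) <= (num_colours chi M)%:R.
Proof.
have /andP[c2 _] := hc.
(* [16] comes from bounding [4 * y ^ 2], and [n >= 1] makes the cube root at least one; [c > 1 / 2]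
   gives [n] below twice the minimum degree. *)
exists 16, 1; split; first by [].
move=> n n0 V G bG cn C chi pchi.
have [y [ny yn]] := exists_cube_root_bound R n0.
have nd : (n < (min_degree G).*2)%N.
  rewrite -(ltr_nat R) -muln2 natrM.
  have : 0 < n%:R :> R by rewrite ltr0n.
  nra.
have [M [pM dM]] := exists_colourful_perfect_matching bG pchi n0 nd ny.
exists M; split=> //.
move: dM; rewrite -(ler_nat R) natrD; lra.
Qed.
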